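(* Let $(T_k)_{k\ge1}$ be a sequence of continuous linear operators from $\omega$ to $\omega$, and write $T_ke_j=(a^{(k)}_{i,j})_{i\ge0}$ for $j\ge0$. If for any $N\ge0$, any $l\ge1$ and any $K\ge1$, there exists $k\ge K$ such that $$\mathrm{span}\{(a^{(k)}_{i,j})_{i=0,\dots,l-1}:j\ge N\}=\mathbb{K}^l,$$ then $(T_k)$ possesses a hypercyclic subspace.
   Context: $\mathbb{K}=\mathbb{R}$ or $\mathbb{C}$; $\omega=\mathbb{K}^{\mathbb{Z}_+}$ (sequences indexed by the non-negative integers) endowed with the product topology; $(e_n)_{n\ge0}$ is its canonical basis. A vector $x\in\omega$ is hypercyclic for $(T_k)$ if $\{T_kx\}_k$ is dense in $\omega$; a hypercyclic subspace for $(T_k)$ is a closed infinite-dimensional subspace of $\omega$ in which every non-zero vector is hypercyclic for $(T_k)$. *)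

(* Defs.v *)
From HB Require Import structures.
From mathcomp Require Import all_boot all_order all_algebra.
From mathcomp Require Import all_classical all_reals all_analysis.
From mathcomp Require Import complex.

Set Implicit Arguments.
Unset Strict Implicit.
Unset Printing Implicit Defensive.

Import Order.TTheory GRing.Theory Num.Theory.
Import numFieldNormedType.Exports.

Local Open Scope classical_set_scope.
Local Open Scope ring_scope.

(* [K^o] carries the metric topology given by the norm of [K]; a
   [prod_topology] has no algebraic structure in the library, so the pointwise
   vector space operations are copied from the function space. *)
Definition omega (K : numFieldType) : Type :=
  prod_topology (fun _ : nat => K^o).

HB.instance Definition _ (K : numFieldType) := Topological.on (omega K).
HB.instance Definition _ (K : numFieldType) :=
  GRing.Lmodule.copy (omega K) (nat -> K^o).

Definition omega_basis (K : numFieldType) (j : nat) : omega K :=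
  fun i => (i == j)%:R.

Definition omega_trunc (K : numFieldType) (l : nat) (x : omega K) : 'rV[K]_l :=
  \row_(i < l) x i.

(* Finite linear combinations; the library's [span] only takes finite
   sequences of vectors of a finite-dimensional space. *)
Definition linear_span (K : numFieldType) (V : lmodType K) (S : set V) : set V :=
  [set v | exists (n : nat) (c : 'I_n -> K) (s : 'I_n -> V),
     (forall i, S (s i)) /\ v = \sum_(i < n) c i *: s i].

Definition finite_dimensional (K : numFieldType) (V : lmodType K) (M : set V) :=
  exists S : set V, finite_set S /\ linear_span S = M.

Definition hypercyclic_vector (K : numFieldType)
    (T : nat -> omega K -> omega K) (x : omega K) : Prop :=
  dense [set T k x | k in [set k | (1 <= k)%N]].

Definition hypercyclic_subspace (K : numFieldType)
    (T : nat -> omega K -> omega K) (M : set (omega K)) : Prop :=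
  [/\ submod_closed (mem M), closed M, ~ finite_dimensional M
    & forall x, M x -> x <> 0 -> hypercyclic_vector T x].

(* Main.v *)
Require Import Defs.
From mathcomp Require Import all_boot all_order all_algebra.
From mathcomp Require Import all_classical all_reals all_analysis.
From mathcomp Require Import complex.

(** The subspace is the solution set of a list of linear equations.  Let [d] be
a dense sequence of scalars, and let [s |-> (p_s, y_s)] enumerate the pairs of
a coordinate [p] and a finite tuple [y] with entries among the [d n].  For
well chosen indices [k_s >= 1] put

  M = {x | for all s and all i < size y_s, (T_{k_s} x)_i = x_{p_s} * y_{s,i}}.

It is a closed linear subspace, whatever the [k_s].  A nonzero [x] of [M] has a
coordinate [x_p != 0]; the equations with [p_s = p] say that the initial
segments of the vectors [T_k x] run through [x_p] times every finite tuple with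
entries in the dense sequence, so [x] is hypercyclic
([hypercyclic_vector_of_proportional_images]).

The choice of the [k_s] is only there to make [M] infinite-dimensional.  A
continuous operator has rows of finite support
([continuous_linear_finite_rows]), so the equations of stage [s] involve only
the coordinates below some bound [N_{s+1}].  The spanning hypothesis, applied
to the columns beyond both [N_s] and [p_s], provides [k_s] such that these
equations can be satisfied by changing coordinates beyond [N_s] only, leaving
the right-hand sides unchanged ([adapted_block]).  The equations can therefore
be solved one stage after the other ([simultaneous_solution]).  Starting from
the basis vector [e_{N_n}], which satisfies all stages before [n], one gets an
element of [M] whose first nonzero coordinate is the one of index [N_n], for
every [n]; such a family is linearly independent
([infinite_dimensional_of_triangular_family]). *)

Set Implicit Arguments.
Unset Strict Implicit.
Unset Printing Implicit Defensive.

Import Order.TTheory GRing.Theory Num.Theory.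
Import numFieldNormedType.Exports.
Local Open Scope classical_set_scope.
Local Open Scope ring_scope.

(** * Dense sequences of scalars *)

Lemma real_dense_sequence (R : realType) :
  exists d : nat -> R, forall z e : R, 0 < e -> exists n, `|d n - z| < e.
Proof.
exists (fun n => ratr (odflt 0 (unpickle n : option rat))) => z e e0.
have ze : z - e < z + e by rewrite ltrD2l gtrN.
have [q] := rat_in_itvoo ze.
rewrite in_itv /= => /andP[lb ub]; exists (pickle q).
by rewrite pickleK /= ltr_distl lb ub.
Qed.

Lemma complex_dense_sequence (R : realType) :
  exists d : nat -> R[i], forall z e : R[i], 0 < e -> exists n, `|d n - z| < e.
Proof.
have [d dP] := real_dense_sequence R.
pose code n : nat * nat := odflt (0, 0)%N (unpickle n).
exists (fun n => Complex (d (code n).1) (d (code n).2)) => -[a b] [e e'].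
rewrite ltcE /= => /andP[/eqP-> e0].
have e20 : 0 < e / 2 by rewrite divr_gt0.
have [m mP] := dP a _ e20; have [n nP] := dP b _ e20.
exists (pickle (m, n)); rewrite /code pickleK /=.
rewrite normc_def /= ltcR.
set u := d m - a in mP *; set v := d n - b in nP *.
rewrite -(gtr0_norm e0) -sqrtr_sqr ltr_sqrt ?exprn_gt0//.
rewrite -(real_normK (num_real u)) -(real_normK (num_real v)).
rewrite (splitr e) sqrrD (@lt_le_trans _ _ ((e / 2) ^+ 2 + (e / 2) ^+ 2)) //.
  by rewrite ltrD // ltr_pXn2r ?nnegrE // ltW.
by rewrite [leRHS]addrAC lerDl mulrn_wge0 // mulr_ge0 // ltW.
Qed.

(** * Coordinates and topology of the sequence space *)

Section Omega.
Variable K : numFieldType.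
Implicit Types (x w z : omega K) (O : set (omega K)) (l i j p N : nat).

Lemma omegaD x w i : (x + w) i = x i + w i. Proof. by []. Qed.
Lemma omegaZ (a : K) x i : (a *: x) i = a * x i. Proof. by []. Qed.
Lemma omega0 i : (0 : omega K) i = 0. Proof. by []. Qed.
Lemma omegaB x w i : (x - w) i = x i - w i. Proof. by []. Qed.
Lemma omega_sum n (f : 'I_n -> omega K) i : (\sum_(j < n) f j) i = \sum_(j < n) f j i.
Proof. by apply: (big_morph (fun y : omega K => y i)). Qed.

Lemma coord_continuous i : continuous (fun x => x i : K^o).
Proof. exact: (@proj_continuous nat (fun=> K^o) i). Qed.

(** Comparing this filter with [nbhs z] through the universal property of the
product topology avoids handling finite intersections of open sets. *)
Let cylinders z : set_system (omega K) := [set O | exists l (e : K),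
  0 < e /\ forall w, (forall i, (i < l)%N -> `|w i - z i| < e) -> O w].

Let cylinders_filter z : Filter (cylinders z).
Proof.
split.
- by exists 0%N, 1.
- move=> A B [l [e [e0 lA]]] [l' [e' [e'0 lB]]].
  exists (maxn l l'), (Num.min e e'); have cee : (e >=< e')%O.
    by apply: real_comparable; apply: gtr0_real.
  rewrite comparable_lt_min // e0 e'0; split => // w wP.
  split; [apply: lA|apply: lB] => i il.
    by have := wP i; rewrite leq_max il comparable_lt_min// => /(_ isT)/andP[].
  by have := wP i; rewrite leq_max il orbT comparable_lt_min// => /(_ isT)/andP[].
- move=> A B AB [l [e [e0 lA]]]; exists l, e; split => // w /lA; exact: AB.
Qed.

Lemma nbhs_cylinder z O : nbhs z O -> exists l (e : K),
  0 < e /\ forall w, (forall i, (i < l)%N -> `|w i - z i| < e) -> O w.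
Proof.
suff : cylinders z --> z by apply.
have FF := cylinders_filter z; apply/cvg_sup => i A /= [_ [[B Bop <-] Bzi BA]].
have /nbhs_ballP[e /= e0 eB] : nbhs (z i : K^o) B by exact: open_nbhs_nbhs.
exists i.+1, e; split => // w wP; apply: BA; apply: eB.
by rewrite -ball_normE /ball_ /= distrC; exact: wP.
Qed.

(** A coordinate of [T x] is a linear form bounded by 1 on a cylinder around 0.
A vector vanishing on the base of that cylinder has all its multiples in it,
and a linear form bounded on a line through 0 vanishes there. *)
Lemma continuous_linear_finite_rows (T : {linear omega K -> omega K}) l :
  continuous T ->
  exists B, forall x, (forall j, (j < B)%N -> x j = 0) ->
    forall i, (i < l)%N -> T x i = 0.
Proof.
move=> Tc.
have row i : exists B, forall x, (forall j, (j < B)%N -> x j = 0) -> T x i = 0.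
  have : nbhs (0 : omega K) [set x | `|T x i| < 1].
    have ct : {for 0, continuous (fun x => T x i : K^o)}.
      by apply: (@continuous_comp _ _ _ T (fun x : omega K => x i : K^o));
        [exact: Tc|exact: coord_continuous].
    have /ct : nbhs (T 0 i : K^o) [set t | `|t| < 1].
      apply/nbhs_ballP; exists 1 => //= t.
      by rewrite -ball_normE /ball_ /= linear0 omega0 sub0r normrN.
    by [].
  move=> /nbhs_cylinder[B [e [e0 eB]]]; exists B => x x0.
  have small a : `|a * T x i| < 1.
    rewrite -omegaZ -linearZ; apply: eB => j /x0 xj.
    by rewrite omegaZ xj mulr0 subrr normr0.
  apply/eqP/negPn/negP => /mulVf n0.
  by have := small (T x i)^-1; rewrite n0 normr1 ltxx.
have [B BP] := choice row.
exists (\max_(i < l) B i)%N => x x0 i il; apply: BP => j jB.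
by apply: x0; apply: leq_trans jB _; exact: (leq_bigmax (Ordinal il)).
Qed.

(** * Infinite dimension *)

(** If [n] vectors spanned [M], the coordinates of index [q 0, ..., q n] would
map [M] into a space of row vectors of rank at most [n]; but the images of
[x 0, ..., x n] form a triangular matrix with nonzero diagonal. *)
Lemma infinite_dimensional_of_triangular_family (M : set (omega K)) (q : nat -> nat)
    (x : nat -> omega K) :
  (forall n, M (x n)) -> (forall n, x n (q n) != 0) ->
  (forall m n, (m < n)%N -> x n (q m) = 0) -> ~ finite_dimensional M.
Proof.
move=> Mx xq xq0 [S [/finite_seqP[s ->]]] SM.
pose n := size s.
pose rho (y : omega K) : 'rV[K]_n.+1 := \row_(m < n.+1) y (q m).
pose A := \matrix_(i < n) rho (nth 0 s i).
pose X := \matrix_(m < n.+1) rho (x m).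
have XA : (X <= A)%MS.
  apply/row_subP => m; rewrite rowK.
  have : M (x m) by [].
  rewrite -SM => -[k [c [f [fs ->]]]].
  have -> : rho (\sum_(i < k) c i *: f i) = \sum_(i < k) c i *: rho (f i).
    apply/rowP => j; rewrite mxE omega_sum summxE.
    by apply: eq_bigr => i _; rewrite !mxE.
  apply: summx_sub => i _; apply: scalemx_sub.
  have fi : f i \in s by exact: fs.
  rewrite -(nth_index 0 fi).
  have lt : (index (f i) s < n)%N by rewrite index_mem.
  by have := row_sub (Ordinal lt) A; rewrite rowK.
have : \det X^T != 0.
  rewrite det_trig; first by apply/prodf_neq0 => m _; rewrite !mxE.
  by apply/is_trig_mxP => i j ij; rewrite !mxE xq0.
rewrite det_tr -unitfE -unitmxE => /mxrank_unit rX.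
by have := leq_trans (mxrankS XA) (rank_leq_row A); rewrite rX ltnn.
Qed.

(** * Solving infinitely many conditions in turn *)

(** Satisfying condition [t] changes only coordinates beyond [N t], on which
the conditions before [t] do not depend.  The successive corrections stabilise
coordinatewise, and each condition sees only coordinates already stable. *)
Lemma simultaneous_solution (C : nat -> set (omega K)) (N : nat -> nat) :
  (forall t, (N t < N t.+1)%N) ->
  (forall t x w, (forall j, (j < N t.+1)%N -> x j = w j) -> C t x -> C t w) ->
  (forall t x, exists w, (forall j, (j <= N t)%N -> w j = x j) /\ C t w) ->
  forall x, exists w, (forall j, (j <= N 0)%N -> w j = x j) /\ forall t, C t w.
Proof.
move=> N_incr C_local C_ext x.
have Nmono : {homo N : m n / (m <= n)%N}.
  by apply: homo_leq => [n|m n p mn np|n]; [exact: leqnn|exact: leq_trans mn np|exact: ltnW].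
have tN t : (t <= N t)%N by elim: t => // t IH; exact: leq_ltn_trans IH (N_incr t).
have [g gP] := choice (fun tx : nat * omega K => C_ext tx.1 tx.2).
pose z := fix z t := if t is t'.+1 then g (t', z t') else x.
have zS t j : (j <= N t)%N -> z t.+1 j = z t j by have [gz _] := gP (t, z t); exact: gz.
have z_stable t j u : (j <= N t)%N -> z (t + u)%N j = z t j.
  move=> jt; elim: u => [|u IH]; first by rewrite addn0.
  by rewrite addnS zS// (leq_trans jt)// Nmono// leq_addr.
have diag t j : (j <= N t)%N -> z j j = z t j.
  (* As [t <= N t], coordinate [j] no longer moves from step [j] on. *)
  move=> jt; have [tj|/ltnW jt'] := leqP t j.
    by rewrite -(subnKC tj) z_stable ?subnKC.
  by rewrite -(z_stable j j (t - j)%N) ?subnKC.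
exists (fun j => z j j); split => [j|t]; first exact: diag.
apply: (C_local t (z t.+1)); last by have [] := gP (t, z t).
by move=> j /ltnW /diag.
Qed.

(** * The equations defining the subspace *)

(** The target is multiplied by the coordinate [x p] so that the condition is
linear in [x]; where [x p != 0] it prescribes [A x] up to a nonzero scalar. *)
Definition proportional_image (A : omega K -> omega K) (p l : nat) (y : nat -> K) :
    set (omega K) :=
  [set x | forall i, (i < l)%N -> A x i = x p * y i].

Lemma proportional_image_submod (A : {linear omega K -> omega K}) p l y
    (a : K) x w :
  proportional_image A p l y x -> proportional_image A p l y w ->
  proportional_image A p l y (a *: x + w).
Proof.
move=> Cx Cw i il.
by rewrite linearP !omegaD !omegaZ (Cx i il) (Cw i il) mulrDl mulrA.
Qed.

Lemma proportional_image_closed (A : {linear omega K -> omega K}) p l y :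
  continuous A -> closed (proportional_image A p l y).
Proof.
move=> Ac.
have -> : proportional_image A p l y =
    \bigcap_(i in [set i | (i < l)%N]) [set x | A x i - x p * y i = 0].
  apply/seteqP; split => x Cx i /Cx; first by move=> /= ->; rewrite subrr.
  by move=> /eqP; rewrite subr_eq0 => /eqP.
apply: closed_bigI => i _.
apply: (@preimage_closed _ _ (fun x : omega K => (A x i - x p * y i : K^o))
          [set 0]); last first.
  exact/accessible_closed_set1/hausdorff_accessible/norm_hausdorff.
move=> x _; apply: (@continuousB _ _ _ (fun x => A x i : K^o)
    (fun x => x p * y i : K^o)).
  exact: (@continuous_comp _ _ _ A (fun x => x i : K^o) x (Ac x)
            (@coord_continuous i (A x))).
by apply: (@continuousM _ _ (fun x => x p : K^o) (fun=> y i : K^o));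
  [exact: coord_continuous|exact: cst_continuous].
Qed.

Lemma proportional_image_local (A : {linear omega K -> omega K}) p l y B :
  (forall x, (forall j, (j < B)%N -> x j = 0) ->
     forall i, (i < l)%N -> A x i = 0) -> (p < B)%N ->
  forall x w, (forall j, (j < B)%N -> x j = w j) ->
    proportional_image A p l y x -> proportional_image A p l y w.
Proof.
move=> AB pB x w xw Cx i il; rewrite -xw// -Cx//; apply/eqP.
rewrite -subr_eq0 -omegaB -linearB; apply/eqP; apply: AB => // j jB.
by rewrite omegaB xw// subrr.
Qed.

(** The correction is supported on the columns from [N] on, and [p < N], so the
right-hand side [x p * y i] is not affected by it. *)
Lemma proportional_image_extension (A : {linear omega K -> omega K}) p l y N :
  (p < N)%N ->
  linear_span [set omega_trunc l (A (omega_basis K j)) | j in [set j | (N <= j)%N]]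
    = [set: 'rV[K]_l] ->
  forall x, exists w, (forall j, (j < N)%N -> w j = x j) /\
    proportional_image A p l y w.
Proof.
move=> pN Aspan x.
have : [set: 'rV[K]_l] (\row_(i < l) (x p * y i - A x i)) by [].
rewrite -Aspan => -[n [c [s [sP vE]]]].
have /choice[j jP] m : exists j, (N <= j)%N /\ omega_trunc l (A (omega_basis K j)) = s m.
  by have [j jN <-] := sP m; exists j.
pose u := \sum_(m < n) c m *: omega_basis K (j m).
have u0 t : (t < N)%N -> u t = 0.
  move=> tN; rewrite /u omega_sum big1// => m _; rewrite omegaZ /omega_basis.
  have [jN _] := jP m.
  by rewrite (ltn_eqF (leq_trans tN jN)) mulr0.
exists (x + u); split => [t tN|i il]; first by rewrite omegaD u0 ?addr0.
rewrite linearD !omegaD u0// addr0.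
have := congr1 (fun v : 'rV_l => v 0 (Ordinal il)) vE.
rewrite mxE /= => /(canRL (subrK _)) ->; rewrite addrC; congr (_ + _).
rewrite /u linear_sum omega_sum summxE; apply: eq_bigr => m _.
by rewrite linearZ /= omegaZ; have [_ <-] := jP m; rewrite !mxE.
Qed.

(** One stage of the construction: an index [kB.1] and a bound [kB.2] for the
next block of coordinates.  The last two conclusions are the hypotheses of
[simultaneous_solution]. *)
Lemma adapted_block (T : nat -> {linear omega K -> omega K}) :
  (forall k : nat, (1 <= k)%N -> continuous (T k)) ->
  (forall N l : nat, (1 <= l)%N -> exists k : nat, (1 <= k)%N /\
     linear_span [set omega_trunc l (T k (omega_basis K j)) | j in [set j | (N <= j)%N]]
       = [set: 'rV[K]_l]) ->
  forall p l (y : nat -> K) N, (1 <= l)%N -> exists kB : nat * nat,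
  [/\ (1 <= kB.1)%N, (N < kB.2)%N,
      forall x w, (forall j, (j < kB.2)%N -> x j = w j) ->
        proportional_image (T kB.1) p l y x -> proportional_image (T kB.1) p l y w
    & forall x, exists w, (forall j, (j <= N)%N -> w j = x j) /\
        proportional_image (T kB.1) p l y w].
Proof.
move=> T_cont T_span p l y N l1.
have [k [k1 kspan]] := T_span (maxn N p).+1 l l1.
have [B BP] := continuous_linear_finite_rows l (T_cont k k1).
exists (k, maxn B (maxn N p).+1); split => //=.
- by rewrite leq_max ltnS leq_maxl orbT.
- apply: proportional_image_local; last by rewrite leq_max ltnS leq_maxr orbT.
  by move=> x x0; apply: BP => j jB; apply: x0; rewrite leq_max jB.
- move=> x; have pN : (p < (maxn N p).+1)%N by rewrite ltnS leq_maxr.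
  have [w [wx Cw]] := proportional_image_extension y pN kspan x.
  by exists w; split => // j jN; apply: wx; rewrite ltnS leq_max jN.
Qed.

(** * Hypercyclicity *)

(** To approach [z] it suffices that the tuple approaches [z / x p]. *)
Lemma hypercyclic_vector_of_proportional_images
    (T : nat -> omega K -> omega K) (d : nat -> K) x p :
  (forall z e : K, 0 < e -> exists n, `|d n - z| < e) -> x p != 0 ->
  (forall v : seq nat, exists2 k, (1 <= k)%N &
     proportional_image (T k) p (size v) (fun i => d (nth 0 v i)) x) ->
  hypercyclic_vector T x.
Proof.
move=> d_dense xp0 Tx O [z Oz] Oo.
have [l [e [e0 lO]]] := nbhs_cylinder (open_nbhs_nbhs (conj Oo Oz)).
have ex : 0 < e / `|x p| by rewrite divr_gt0// normr_gt0.
have [n nP] := choice (fun i => d_dense (z i / x p) _ ex).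
have [k k1 Ck] := Tx (mkseq n l).
exists (T k x); split; last by exists k.
apply: lO => i il.
rewrite Ck ?size_mkseq// nth_mkseq//.
have := nP i; rewrite ltr_pdivlMr ?normr_gt0// -normrM mulrBl divfK//.
by rewrite mulrC.
Qed.

(** The real and the complex case differ only by the dense sequence [d], which
makes the conditions to be met countable in number. *)
Lemma hypercyclic_subspace_of_spanning_columns
    (d : nat -> K) (T : nat -> {linear omega K -> omega K}) :
  (forall z e : K, 0 < e -> exists n, `|d n - z| < e) ->
  (forall k : nat, (1 <= k)%N -> continuous (T k)) ->
  (forall N l : nat, (1 <= l)%N -> exists k : nat, (1 <= k)%N /\
     linear_span [set omega_trunc l (T k (omega_basis K j)) | j in [set j | (N <= j)%N]]
       = [set: 'rV[K]_l]) ->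
  exists M : set (omega K), hypercyclic_subspace T M.
Proof.
move=> d_dense T_cont T_span.
pose code s : nat * seq nat := odflt (0, [::])%N (unpickle s).
(* Tuples are taken of length [(size v).+1], padded with [d 0], because the
   spanning hypothesis concerns positive lengths. *)
pose C s k := proportional_image (T k) (code s).1 (size (code s).2).+1
                (fun i => d (nth 0 (code s).2 i)).
have [kB kBP] := choice (fun sN : nat * nat =>
  adapted_block T_cont T_span (code sN.1).1
    (fun i => d (nth 0 (code sN.1).2 i)) sN.2 (ltn0Sn (size (code sN.1).2))).
pose N := fix N s := if s is s'.+1 then (kB (s', N s')).2 else 0%N.
pose k s := (kB (s, N s)).1.
have k1 s : (1 <= k s)%N by have [] := kBP (s, N s).
have N_incr s : (N s < N s.+1)%N by have [] := kBP (s, N s).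
have C_local s x w : (forall j, (j < N s.+1)%N -> x j = w j) ->
    C s (k s) x -> C s (k s) w.
  by have [_ _ loc _] := kBP (s, N s); exact: loc.
have C_ext s x : exists w, (forall j, (j <= N s)%N -> w j = x j) /\ C s (k s) w.
  by have [_ _ _ ext] := kBP (s, N s); exact: ext.
have C0 s : C s (k s) 0 by move=> i _; rewrite linear0 !omega0 mul0r.
have N_le : {homo N : m n / (m <= n)%N}.
  apply: homo_leq => [n|n m p mn np|n]; [exact: leqnn|exact: leq_trans mn np|].
  exact: ltnW.
exists (\bigcap_(s in setT) C s (k s)); split.
- split; first by apply/mem_set => s _; exact: C0.
  move=> a x w /set_mem Mx /set_mem Mw; apply/mem_set => s _.
  by apply: proportional_image_submod; [exact: Mx|exact: Mw].
- by apply: closed_bigI => s _; apply: proportional_image_closed; exact: T_cont.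
- have sol n : exists x, (forall j, (j <= N n)%N -> x j = omega_basis K (N n) j) /\
      forall s, C s (k s) x.
    (* Stages from [n] on are solved by extension; the previous ones are met
       because the solution vanishes on the coordinates they involve. *)
    have NS t : N (n + t.+1)%N = N (n + t)%N.+1 by rewrite addnS.
    have [||t|x [xE Cx]] := @simultaneous_solution (fun t => C (n + t)%N (k (n + t)%N))
      (fun t => N (n + t)%N) _ _ _ (omega_basis K (N n)).
    + by move=> t; rewrite NS.
    + by move=> t; rewrite NS; exact: C_local.
    + exact: C_ext.
    rewrite addn0 in xE; exists x; split => // s.
    have [/subnKC <-//|sn] := leqP n s.
    apply: (C_local s 0) => // j js; have jn := leq_trans js (N_le _ _ sn).
    by rewrite xE 1?ltnW// /omega_basis ltn_eqF.
  have [x xP] := choice sol.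
  apply: (@infinite_dimensional_of_triangular_family _ N x) => [n s _|n|m n mn].
  + by have [_] := xP n; exact.
  + by have [-> //] := xP n; rewrite /omega_basis eqxx oner_neq0.
  + have lt : (N m < N n)%N := leq_trans (N_incr m) (N_le _ _ mn).
    by have [-> //] := xP n; rewrite 1?ltnW// /omega_basis ltn_eqF.
- move=> x Mx x0.
  have [p xp0] : exists p, x p != 0.
    apply: contrapT => /forallNP xp; apply: x0; apply/funext => p.
    by apply/eqP/negPn/negP; exact: xp.
  apply: (hypercyclic_vector_of_proportional_images d_dense xp0) => v.
  exists (k (pickle (p, v))) => // i iv.
  have := Mx (pickle (p, v)) I i; rewrite /code pickleK /=; apply.
  exact: ltnW.
Qed.
End Omega.

Theorem theorem4p8 (R : realType) (K : numFieldType)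
  (hK : K = (R : numFieldType) \/ K = (R[i] : numFieldType))
  (T : nat -> {linear omega K -> omega K})
  (T_cont : forall k : nat, (1 <= k)%N -> continuous (T k))
  (T_span : forall N l K0 : nat, (1 <= l)%N -> (1 <= K0)%N ->
     exists k : nat, (K0 <= k)%N /\
       linear_span [set omega_trunc l (T k (omega_basis K j)) | j in [set j | (N <= j)%N]]
         = [set: 'rV[K]_l]) :
  exists M : set (omega K), hypercyclic_subspace T M.
Proof.
have [d d_dense] : exists d : nat -> K,
    forall z e : K, 0 < e -> exists n, `|d n - z| < e.
  by case: hK => ->; [exact: real_dense_sequence|exact: complex_dense_sequence].
apply: (hypercyclic_subspace_of_spanning_columns d_dense T_cont) => N l l1.
exact: T_span.
Qed.
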